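(* Let $L_+$, $L_-$ and $L_0$ be three oriented starred linkoid diagrams in $S^2$ which differ from each other at a unique crossing $v$, where $v$ is positive in $L_+$, negative in $L_-$, and smoothed in the oriented way in $L_0$. Then the skein relation $$\nabla_{L_+}(W)-\nabla_{L_-}(W)=(W-W^{-1})\nabla_{L_0}(W)$$ holds if $v$ is not a separating crossing.
   Context: A linkoid diagram in $S^2$ is a generic immersion of finitely many unit intervals (long components, oriented from tail to head) and oriented circles, with finitely many transverse double points, each carrying over/under information (crossings); the endpoints of the long components are distinct from each other and from the crossings. The universe is the graph obtained by turning each crossing into a 4-valent vertex and each endpoint into a 1-valent vertex; regions are the connected components of its complement. A diagram is split if its universe is disconnected. A crossing $v$ of a link or linkoid diagram is separating (nugatory) if at least one of the two resolutions (smoothings) of $v$ results in a split diagram. A starred diagram is a diagram together with stars placed either on some of its regions or on some of its crossings (possibly no stars) so that the number of unstarred regions equals the number of unstarred crossings. The diagrams $L_+,L_-,L_0$ carry corresponding stars: the oriented smoothing at $v$ merges the in-corner and out-corner regions at $v$ into one region $F$ of $L_0$, which is starred exactly when one of the merged regions is starred; all other regions and crossings keep their stars. Labels. At each crossing there are four local regions (corners): the out-corner (between the two outgoing edges), the in-corner (between the two incoming edges) and two side corners. At a positive crossing the out-corner has label $W$, the in-corner $-W^{-1}$, and both side corners $1$. At a negative crossing the out-corner has label $W^{-1}$, the in-corner $-W$, and both side corners $1$. A state of a starred diagram assigns to every unstarred region one marker, placed at a corner of that region at an unstarred crossing, so that every unstarred crossing receives exactly one marker (if a region occupies several corners at one crossing,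 different corners give different states). The weight of a state is the product of the labels of the marked corners. The mock Alexander polynomial $\nabla_L(W)$ is the sum of the weights of all states of $L$. *)

(* Defs.v *)
(* Linkoid diagrams in the sphere are encoded by their universe, given as a
   combinatorial map on a finite type D of darts (half-edges): [rot] turns a
   dart counterclockwise to the next dart at the same vertex, [opp] sends a dart
   to the other half of its edge.  Crossings are the 4-valent vertices and
   endpoints the 1-valent ones.  2-valent vertices are mere subdivision points
   of edges: they let a circle without crossings be represented, and make it
   possible to smooth a crossing without changing the set of darts.

   A dart d also names the corner lying between d and [rot d].

   A diagram may be disconnected.  Its regions are therefore not the boundary
   cycles of the map but a partition of the corners which is coarser than the
   partition into boundary cycles; see [planar_components] and
   [regions_tree].  The empty diagram has no encoding. *)

From mathcomp Require Import all_boot all_algebra all_fingroup.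

Set Implicit Arguments.
Unset Strict Implicit.
Unset Printing Implicit Defensive.

Import GRing.Theory.
Local Open Scope ring_scope.

Definition adjacent (D : finType) (rot opp : {perm D}) : rel D :=
  [rel x y | (rot x == y) || (opp x == y)].

Definition num_components (D : finType) (rot opp : {perm D}) : nat :=
  n_comp (adjacent rot opp) [pred x : D | true].

Definition split_universe (D : finType) (rot opp : {perm D}) : bool :=
  [exists x, exists y, ~~ connect (adjacent rot opp) x y].

(* d |-> rot^-1 (opp d): the next corner when running along the boundary of a
   region, keeping the region on the left. *)
Definition boundary (D : finType) (rot opp : {perm D}) : {perm D} :=
  (opp * rot^-1)%g.

Record diagram (D : finType) := Diagram {
  rot : {perm D};
  opp : {perm D};
  outgoing : {set D};  (* darts directed away from their vertex *)
  over : {set D};      (* darts of the overpassing strand at a crossing *)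
  regions : {set {set D}};

  opp_invol : forall d, opp (opp d) = d;
  opp_neq : forall d, opp d != d;
  valency : forall d, #|porbit rot d| \in [:: 1; 2; 4]%N;

  outgoing_opp : forall d, (opp d \in outgoing) = (d \notin outgoing);
  outgoing_valency2 : forall d, #|porbit rot d| = 2%N ->
    (rot d \in outgoing) = (d \notin outgoing);
  outgoing_crossing : forall d, #|porbit rot d| = 4%N ->
    (rot (rot d) \in outgoing) = (d \notin outgoing);

  over_crossing : forall d, #|porbit rot d| = 4%N ->
    (rot d \in over) = (d \notin over);
  over_only_crossing : forall d, d \in over -> #|porbit rot d| = 4%N;

  regions_partition : partition regions [set: D];
  regions_boundary : forall A d, A \in regions -> d \in A ->
    boundary rot opp d \in A;

  (* V + F = E + 2C.  As V + F <= E + 2 holds for each component, this says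
     that every component of the universe has genus 0. *)
  planar_components :
    (#|porbits rot| + #|porbits (boundary rot opp)|
       = #|porbits opp| + 2 * num_components rot opp)%N;

  (* The surface obtained by filling each region with a planar surface bounded
     by its boundary cycles is the sphere: the bipartite graph whose vertices
     are the components of the universe and the regions, with one edge for each
     boundary cycle, is a tree (connected, with one edge less than vertices). *)
  regions_connected : forall x y,
    connect [rel a b | adjacent rot opp a b || (b \in pblock regions a)] x y;
  regions_tree :
    (#|porbits (boundary rot opp)| + 1
       = num_components rot opp + #|regions|)%N
}.

Definition crossings (D : finType) (L : diagram D) : {set {set D}} :=
  [set X in porbits (rot L) | #|X| == 4%N].

(* The following two are meant for corners d at a crossing. *)
Definition out_corner (D : finType) (L : diagram D) (d : D) : bool :=
  (d \in outgoing L) && (rot L d \in outgoing L).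

Definition in_corner (D : finType) (L : diagram D) (d : D) : bool :=
  (d \notin outgoing L) && (rot L d \notin outgoing L).

(* A crossing is positive when turning its outgoing over-edge counterclockwise
   through the out-corner leads to its outgoing under-edge. *)
Definition positive (D : finType) (L : diagram D) (v : {set D}) : bool :=
  [exists d in v, out_corner L d && (d \in over L)].

(* The rotation after replacing the crossing of d by the two 2-valent vertices
   {d, rot^3 d} and {rot d, rot^2 d}: the resolution which merges the regions
   at the opposite corners d and rot^2 d. *)
Definition resolve (D : finType) (rot : {perm D}) (d : D) : {perm D} :=
  (tperm d (rot (rot d)) * rot)%g.

(* As d runs over the four corners of v, resolve takes each of the two
   resolutions of v as value. *)
Definition separating (D : finType) (L : diagram D) (v : {set D}) : bool :=
  [exists d in v, split_universe (resolve (rot L) d) (opp L)].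

Record starred_diagram (D : finType) := StarredDiagram {
  diag :> diagram D;
  starred_regions : {set {set D}};
  starred_crossings : {set {set D}};
  starred_regions_sub : starred_regions \subset regions diag;
  starred_crossings_sub : starred_crossings \subset crossings diag;
  stars_one_kind : starred_regions = set0 \/ starred_crossings = set0;
  stars_balanced :
    #|regions diag :\: starred_regions|
      = #|crossings diag :\: starred_crossings|
}.

(* Laurent polynomials with integer coefficients are taken inside the field of
   rational functions. *)
Definition W : {fraction {poly int}} := tofrac 'X.

Definition label (D : finType) (L : diagram D) (d : D) :
    {fraction {poly int}} :=
  if positive L (porbit (rot L) d) then
    if out_corner L d then W else if in_corner L d then - W^-1 else 1
  else
    if out_corner L d then W^-1 else if in_corner L d then - W else 1.

(* A state is identified with the set of its marked corners. *)
Definition is_state (D : finType) (L : starred_diagram D) (S : {set D}) : bool :=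
  [&& [forall d in S,
         (pblock (regions L) d \notin starred_regions L) &&
         (porbit (rot L) d \in crossings L :\: starred_crossings L)],
      [forall A in regions L :\: starred_regions L, #|A :&: S| == 1%N]
    & [forall X in crossings L :\: starred_crossings L, #|X :&: S| == 1%N]].

Definition mock_alexander (D : finType) (L : starred_diagram D) :
    {fraction {poly int}} :=
  \sum_(S : {set D} | is_state L S) \prod_(d in S) label L d.

(* L' is L with the over/under information at v switched. *)
Record crossing_change (D : finType) (L L' : starred_diagram D) (v : {set D}) :
    Prop := CrossingChange {
  cc_crossing : v \in crossings L;
  cc_rot : rot L' = rot L;
  cc_opp : opp L' = opp L;
  cc_outgoing : outgoing L' = outgoing L;
  cc_over : forall d, d \notin v -> (d \in over L') = (d \in over L);
  cc_positive : positive L v;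
  cc_negative : ~~ positive L' v;
  cc_regions : regions L' = regions L;
  cc_starred_regions : starred_regions L' = starred_regions L;
  cc_starred_crossings : starred_crossings L' = starred_crossings L
}.

Definition merge_blocks (D : finType) (A B X : {set D}) : {set D} :=
  if (X == A) || (X == B) then A :|: B else X.

(* L0 is L with v smoothed in the oriented way; o is the out-corner of v, so
   that rot^2 o is its in-corner.  The merged region is starred as soon as one
   of the merged regions is; that v is starred or that two distinct starred
   regions get merged is ruled out by L0 being balanced. *)
Record oriented_smoothing_at (D : finType) (L L0 : starred_diagram D)
    (v : {set D}) (o : D) : Prop := OrientedSmoothingAt {
  os_crossing : v \in crossings L;
  os_mem : o \in v;
  os_out_corner : out_corner L o;
  os_rot : rot L0 = resolve (rot L) o;
  os_opp : opp L0 = opp L;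
  os_outgoing : outgoing L0 = outgoing L;
  os_over : over L0 = over L :\: v;
  os_regions : regions L0 =
    merge_blocks (pblock (regions L) o) (pblock (regions L) (rot L (rot L o)))
      @: regions L;
  os_starred_regions : starred_regions L0 =
    merge_blocks (pblock (regions L) o) (pblock (regions L) (rot L (rot L o)))
      @: starred_regions L;
  os_starred_crossings : starred_crossings L0 = starred_crossings L :\ v
}.

Definition oriented_smoothing (D : finType) (L L0 : starred_diagram D)
    (v : {set D}) : Prop :=
  exists o : D, oriented_smoothing_at L L0 v o.

(* Main.v *)
(* L_+ and L_- differ only in the labels at v, by W - W^-1 at the out-corner
   and the in-corner and by 0 at the side corners.  So the left-hand side is
   W - W^-1 times the sum, over the states whose marker at v is at the out- or
   in-corner, of the product of the labels away from v.

   As v is not separating, L_+ and L_0 are connected, and Euler's formula shows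
   that L_0 has one region less than L_+: the regions A and B at the out-corner
   and the in-corner are distinct.  Forgetting the marker at v is then a
   bijection onto the states of L_0.  It has an inverse because the region A u B
   of L_0 has exactly one marker if neither A nor B is starred, and none
   otherwise (A and B are not both starred, for balance reasons): in each case
   exactly one of A and B is unstarred and without marker, and the marker at v
   has to be put there. *)

From mathcomp Require Import all_boot all_algebra all_fingroup.
Require Import Defs.

Set Implicit Arguments.
Unset Strict Implicit.
Unset Printing Implicit Defensive.

Import GRing.Theory.
Local Open Scope ring_scope.

(** * Effect of resolving a crossing on vertices and connectivity *)

Section Rotation.

Variables (D : finType) (s : {perm D}) (o : D).
Hypothesis o4 : #|porbit s o| = 4%N.

Lemma crossing_darts : porbit s o =i [:: o; s o; s (s o); s (s (s o))].
Proof. by move=> d; rewrite porbit_traject o4. Qed.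

Lemma crossing_uniq : uniq [:: o; s o; s (s o); s (s (s o))].
Proof. by have := uniq_traject_porbit s o; rewrite o4. Qed.

Lemma crossing_rot4 : s (s (s (s o))) = o.
Proof. by have := iter_porbit s o; rewrite o4. Qed.

Lemma resolve_out d : d \notin porbit s o -> resolve s o d = s d.
Proof.
rewrite crossing_darts !inE !negb_or permM => /and4P[d0 _ d2 _].
by rewrite tpermD // eq_sym.
Qed.

Lemma resolve_porbit_out d :
  d \notin porbit s o -> porbit (resolve s o) d = porbit s d.
Proof.
move=> d_o.
suff E i : ((resolve s o) ^+ i)%g d = (s ^+ i)%g d.
  apply/setP=> e.
  by apply/porbitP/porbitP=> -[i ->]; exists i.
elim: i => [|i IHi]; first by rewrite !expg0.
rewrite !expgSr !permM -permM -/(resolve s o) IHi resolve_out //.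
by rewrite -eq_porbit_mem porbit_perm eq_porbit_mem.
Qed.

(** The resolved rotation preserves the four darts of the crossing, so a cycle of length 4 among
    them would contain [o]. But it sends [o] to [s (s (s o))] and back, which closes the cycle of
    [o] after two steps. *)
Lemma resolve_porbit_in d :
  d \in porbit s o -> #|porbit (resolve s o) d| != 4%N.
Proof.
move=> d_o; apply/eqP=> d4.
have [o0 o2 o3] : [/\ resolve s o o = s (s (s o)),
    resolve s o (s (s o)) = s o & resolve s o (s (s (s o))) = o].
  have := crossing_uniq.
  rewrite /= !inE !negb_or => /and4P[/and3P[_ n2 n3] _ n23 _].
  by rewrite /resolve !permM tpermL tpermR tpermD ?crossing_rot4.
have stable e : e \in porbit s o -> resolve s o e \in porbit s o.
  rewrite !crossing_darts !inE => /or4P[]/eqP->;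
    rewrite ?o0 ?o2 ?o3 ?eqxx ?orbT //.
  have := crossing_uniq.
  rewrite /= !inE !negb_or => /and4P[/and3P[n1 _ _] /andP[n12 _] _ _].
  by rewrite /resolve permM tpermD ?eqxx ?orbT // eq_sym.
have sub : porbit (resolve s o) d \subset porbit s o.
  apply/subsetP=> _ /porbitP[i ->]; elim: i => [|i IHi].
    by rewrite expg0 perm1.
  by rewrite expgSr permM stable.
have E : porbit (resolve s o) d = porbit s o.
  by apply/eqP; rewrite eqEcard sub o4 d4.
have o_d : o \in porbit (resolve s o) d by rewrite E porbit_id.
move: o_d; rewrite -eq_porbit_mem => /eqP oE.
have := uniq_traject_porbit (resolve s o) o.
by rewrite oE d4 /= o0 o3 !inE eqxx !orbT.
Qed.

(** Composing with the transposition of two distinct darts of one cycle cuts that cycle in two. *)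
Lemma card_porbits_resolve : #|porbits (resolve s o)| = #|porbits s|.+1.
Proof.
have := porbits_mul_tperm s o (s (s o)) => /=.
have -> : o \in porbit s (s (s o)).
  by rewrite porbit_sym crossing_darts !inE eqxx !orbT.
have -> : o != s (s o).
  by have := crossing_uniq; rewrite /= !inE !negb_or => /and4P[/and3P[]].
by rewrite addn0 addn1.
Qed.

(** The transposed darts [o] and [s (s o)] lie at the same vertex, so each step of the resolved
    rotation is a chain of steps of [s]. Hence a diagram is connected as soon as one of its
    resolutions is. *)
Lemma connect_resolve opp :
  subrel (connect (adjacent (resolve s o) opp)) (connect (adjacent s opp)).
Proof.
have c1 x : connect (adjacent s opp) x (s x).
  by apply: connect1; rewrite /adjacent /= eqxx.
have o2 : connect (adjacent s opp) o (s (s o)) := connect_trans (c1 o) (c1 _).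
have o4' : connect (adjacent s opp) (s (s o)) o.
  by rewrite -{2}crossing_rot4; apply: connect_trans (c1 _) (c1 _).
apply: connect_sub => x y /orP[]/eqP<-; last first.
  by apply: connect1; rewrite /adjacent /= eqxx orbT.
rewrite permM; apply: connect_trans (c1 _).
by case: tpermP => [->|->|].
Qed.

End Rotation.

(** * Connected universes and their numbers of regions *)

Lemma num_components_connected (D : finType) (s t : {perm D}) (d : D) :
  ~~ split_universe s t -> num_components s t = 1%N.
Proof.
move=> /existsPn h.
have c x y : connect (adjacent s t) x y.
  by have /existsPn/(_ y) := h x; rewrite negbK.
have csym : connect_sym (adjacent s t).
  by move=> x y; exact: etrans (c x y) (esym (c y x)).
(* The dart [d] excludes the empty universe, which is not split but has zero components. *)
rewrite -(n_comp_connect csym d).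
by apply: eq_n_comp_r => y; exact: esym (c d y).
Qed.

(* Both universes are connected, so that the numbers of regions and of boundary
   cycles are both E + 2 - V; resolve adds one vertex and no edge. *)
Lemma card_regions_resolve (D : finType) (L L0 : diagram D) (o : D) :
  #|porbit (rot L) o| = 4%N -> rot L0 = resolve (rot L) o -> opp L0 = opp L ->
  ~~ split_universe (rot L0) (opp L0) -> #|regions L| = #|regions L0|.+1.
Proof.
move=> o4 rot0 opp0 conn0.
have conn : ~~ split_universe (rot L) (opp L).
  apply: contra conn0 => /existsP[x /existsP[y xy]].
  apply/existsP; exists x; apply/existsP; exists y.
  by apply: contra xy; rewrite rot0 opp0; apply: connect_resolve.
have := planar_components L; have := planar_components L0.
have := regions_tree L; have := regions_tree L0.
rewrite !(num_components_connected o) // rot0 opp0 card_porbits_resolve //.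
rewrite muln1 !addn1 !add1n => -[<-] [<-] <- /eqP.
by rewrite addSn -addnS eqn_add2l => /eqP->.
Qed.

(** * Regions and stars under the merging of two regions *)

Section Regions.

Variables (D : finType) (L : diagram D).

Lemma mem_region d : d \in pblock (regions L) d.
Proof. by rewrite mem_pblock (cover_partition (regions_partition L)) inE. Qed.

Lemma region_mem d : pblock (regions L) d \in regions L.
Proof. by rewrite pblock_mem ?(cover_partition (regions_partition L)) ?inE. Qed.

Lemma region_def A d : A \in regions L -> d \in A -> pblock (regions L) d = A.
Proof. exact: def_pblock (partition_trivIset (regions_partition L)). Qed.

End Regions.

Definition unstarred_regions (D : finType) (L : starred_diagram D) :=
  regions L :\: starred_regions L.

Definition unstarred_crossings (D : finType) (L : starred_diagram D) :=
  crossings L :\: starred_crossings L.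

(* The corners a and b of v are the out-corner and the in-corner, in either
   order. *)
Record smoothing_merges (D : finType) (L L0 : starred_diagram D) (v : {set D})
    (a b : D) : Prop := SmoothingMerges {
  sm_crossing : v \in unstarred_crossings L;
  sm_mem : a \in v;
  sm_mem_opp : b \in v;
  sm_neq : pblock (regions L) a != pblock (regions L) b;
  sm_regions : regions L0 =
    merge_blocks (pblock (regions L) a) (pblock (regions L) b) @: regions L;
  sm_starred_regions : starred_regions L0 =
    merge_blocks (pblock (regions L) a) (pblock (regions L) b)
      @: starred_regions L;
  sm_unstarred_crossings :
    unstarred_crossings L0 = unstarred_crossings L :\ v;
  sm_porbit_in : forall d, d \in v -> porbit (rot L0) d \notin crossings L0;
  sm_porbit_out : forall d, d \notin v -> porbit (rot L0) d = porbit (rot L) d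
}.

Lemma merge_blocksC (D : finType) (A B : {set D}) :
  merge_blocks A B =1 merge_blocks B A.
Proof. by move=> X; rewrite /merge_blocks orbC setUC. Qed.

Lemma smoothing_merges_sym (D : finType) (L L0 : starred_diagram D) v a b :
  smoothing_merges L L0 v a b -> smoothing_merges L L0 v b a.
Proof.
case=> *; split; rewrite // 1?eq_sym //.
- by rewrite (eq_imset _ (merge_blocksC _ _)).
- by rewrite (eq_imset _ (merge_blocksC _ _)).
Qed.

Section Merge.

Variables (D : finType) (L L0 : starred_diagram D) (v : {set D}) (a b : D).
Hypothesis sm : smoothing_merges L L0 v a b.

Let R := regions L.
Let A := pblock R a.
Let B := pblock R b.

(** A region containing both [a] and [b] would be equal to [A] and to [B], which are distinct. So
    the merged region cannot be confused with one that survives unchanged. *)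
Lemma merge_notin_regions : A :|: B \notin R.
Proof.
apply: contra (sm_neq sm) => ABR.
by rewrite (region_def ABR) ?(region_def ABR) ?inE ?mem_region ?orbT.
Qed.

(** A star on the union can only come from [A] or [B]: any other starred region is its own image,
    and the union is not a region of [L]. *)
Lemma merged_unstarred :
  (A :|: B \in unstarred_regions L0) =
  (A \in unstarred_regions L) && (B \in unstarred_regions L).
Proof.
rewrite !inE (sm_starred_regions sm) (sm_regions sm) !region_mem !andbT.
have -> : A :|: B \in [set merge_blocks A B X | X in R].
  apply/imsetP; exists A; first exact: region_mem.
  by rewrite /merge_blocks eqxx.
rewrite andbT -negb_or; congr negb; apply/imsetP/orP => [[X X_star]|].
  rewrite /merge_blocks; case: ifP => [/orP[]/eqP XE _|_ E].
  - by left; rewrite /A -XE.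
  - by right; rewrite /B -XE.
  case/negP: merge_notin_regions; rewrite E.
  exact: subsetP (starred_regions_sub L) X X_star.
by case=> h; [exists A | exists B] => //; rewrite /merge_blocks eqxx ?orbT.
Qed.

Lemma unmerged_unstarred X : X != A -> X != B -> X \in R ->
  (X \in unstarred_regions L0) = (X \in unstarred_regions L).
Proof.
move=> XA XB XR; rewrite !inE (sm_starred_regions sm) (sm_regions sm).
have E (P : {set {set D}}) : P \subset R ->
    (X \in [set merge_blocks A B Y | Y in P]) = (X \in P).
  move=> PR; apply/imsetP/idP => [[Y YP]|XP]; last first.
    by exists X => //; rewrite /merge_blocks (negPf XA) (negPf XB).
  rewrite /merge_blocks; case: ifP => _ EX; last by rewrite EX.
  by case/negP: merge_notin_regions; rewrite -EX.
by rewrite !E // starred_regions_sub.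
Qed.

Lemma smoothed_region_in d :
  pblock R d = A \/ pblock R d = B -> pblock (regions L0) d = A :|: B.
Proof.
move=> dAB; apply: region_def.
  rewrite (sm_regions sm); apply/imsetP; exists A; first exact: region_mem.
  by rewrite /merge_blocks eqxx.
by case: dAB => <-; rewrite inE mem_region ?orbT.
Qed.

Lemma smoothed_region_out d :
  pblock R d != A -> pblock R d != B -> pblock (regions L0) d = pblock R d.
Proof.
move=> dA dB; apply: region_def; last exact: mem_region.
rewrite (sm_regions sm); apply/imsetP; exists (pblock R d).
  exact: region_mem.
by rewrite /merge_blocks (negPf dA) (negPf dB).
Qed.

Lemma smoothed_regionP X : X \in regions L0 ->
  X = A :|: B \/ [/\ X \in R, X != A & X != B].
Proof.
rewrite (sm_regions sm) => /imsetP[Y YR ->]; rewrite /merge_blocks.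
by case: ifPn => [_|/norP[YA YB]]; [left | right].
Qed.

End Merge.

(** * States, and the effect of deleting one marker *)

Section States.

Variables (D : finType) (L : starred_diagram D) (S : {set D}).

Lemma stateP : reflect
  [/\ forall d, d \in S -> pblock (regions L) d \in unstarred_regions L,
      forall d, d \in S -> porbit (rot L) d \in unstarred_crossings L,
      forall A, A \in unstarred_regions L -> #|A :&: S| = 1%N &
      forall X, X \in unstarred_crossings L -> #|X :&: S| = 1%N]
  (is_state L S).
Proof.
apply: (iffP and3P) =>
  [[/forall_inP h1 /forall_inP h2 /forall_inP h3]|[h1 h2 h3 h4]].
  split=> [d /h1|d /h1|X /h2/eqP|X /h3/eqP] //; case/andP=> //.
  by rewrite !inE region_mem andbT.
split; apply/forall_inP; first 1 last.
- by move=> X XU; rewrite h3.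
- by move=> X XK; rewrite h4.
move=> d dS; apply/andP; split; last exact: h2.
by have := h1 d dS; rewrite inE => /andP[].
Qed.

End States.

Lemma setIU1_in (D : finType) (X T : {set D}) (a : D) :
  a \in X -> X :&: T = set0 -> X :&: (a |: T) = [set a].
Proof.
by move=> aX XT; rewrite setIUr XT setU0; apply/setIidPr; rewrite sub1set.
Qed.

Lemma setIU1_out (D : finType) (X T : {set D}) (a : D) :
  a \notin X -> X :&: (a |: T) = X :&: T.
Proof.
move=> aX; rewrite setIUr.
have -> : X :&: [set a] = set0.
  by apply/eqP; rewrite setI_eq0 disjoint_sym disjoints1.
by rewrite set0U.
Qed.

Lemma mem_crossing (D : finType) (L : diagram D) X d :
  X \in crossings L -> (d \in X) = (porbit (rot L) d == X).
Proof.
rewrite inE => /andP[/imsetP[e _ ->] _].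
by rewrite eq_porbit_mem.
Qed.

(** Deleting the marker [a] leaves exactly [v] and the region [A] of [a] without marker. In [L0] the
    first is no longer a crossing and the second is fused with [B], so all the other counts are
    unaffected. *)
Lemma state_setU1 (D : finType) (L L0 : starred_diagram D) v a b (T : {set D}) :
  smoothing_merges L L0 v a b ->
  (a \notin T) && is_state L (a |: T) =
  [&& is_state L0 T, pblock (regions L) a \in unstarred_regions L
    & pblock (regions L) a :&: T == set0].
Proof.
move=> sm; set R := regions L; set A := pblock R a; set B := pblock R b.
have vK := sm_crossing sm; have AB : A != B := sm_neq sm.
have vC : v \in crossings L by move: vK; rewrite inE => /andP[].
have regU X : X \in unstarred_regions L -> X \in R by rewrite inE => /andP[].
have croK X : X \in unstarred_crossings L -> X \in crossings L.
  by rewrite inE => /andP[].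
have disj1 X : X \in R -> X != A -> a \notin X.
  by move=> XR; apply: contra => aX; rewrite /A (region_def XR aX).
have disjv X : X \in crossings L -> X != v -> a \notin X.
  move=> XC; apply: contra; rewrite (mem_crossing _ XC) => /eqP<-.
  by rewrite -(mem_crossing _ vC) (sm_mem sm).
apply/andP/and3P.
  (* From [L] to [L0]: [a] is the only marker in [A] and the only one at [v], so [T] meets
     neither. *)
  case=> aT /stateP[h1 h2 h3 h4].
  have AU : A \in unstarred_regions L by apply: h1; rewrite setU11.
  have sub1 (X : {set D}) : a \in X ->
      #|X :&: (a |: T)| = 1%N -> X :&: T = set0.
    move=> aX /eqP/cards1P[x Xx]; apply/setP=> y; rewrite [RHS]inE.
    apply/negP=> yXT.
    have /set1P yx : y \in [set x].
      by rewrite -Xx; apply: subsetP yXT; rewrite setIS // subsetUr.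
    have /set1P ax : a \in [set x] by rewrite -Xx !inE aX eqxx.
    by move: yXT; rewrite yx -ax inE (negPf aT) andbF.
  have AT : A :&: T = set0 by apply: sub1 (h3 _ AU); apply: mem_region.
  have vT : v :&: T = set0 by apply: sub1 (h4 _ vK); apply: sm_mem sm.
  split=> //; last by rewrite AT.
  have dT d : d \in T -> pblock R d != A.
    move=> dT; apply/eqP=> dA.
    have : d \in A :&: T by rewrite -dA inE mem_region.
    by rewrite AT inE.
  have dv d : d \in T -> d \notin v.
    move=> dT'; apply/negP=> dv; have : d \in v :&: T by rewrite inE dv.
    by rewrite vT inE.
  apply/stateP; split.
  - move=> d dT'; have dU : pblock R d \in unstarred_regions L.
      by apply: h1; rewrite inE dT' orbT.
    have [dB|dB] := eqVneq (pblock R d) B.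
      rewrite (smoothed_region_in sm); last by right.
      by rewrite (merged_unstarred sm) AU -/B -dB.
    rewrite (smoothed_region_out sm) ?dT // (unmerged_unstarred sm) ?dT //.
    exact: region_mem.
  - move=> d dT'; rewrite (sm_porbit_out sm) ?dv // (sm_unstarred_crossings sm).
    rewrite in_setD1 h2 ?andbT; last by rewrite inE dT' orbT.
    by rewrite -(mem_crossing _ vC) dv.
  - move=> X XU.
    have XR0 : X \in regions L0 by move: XU; rewrite inE => /andP[].
    have [XAB|[XR XA XB]] := smoothed_regionP sm XR0.
      move: XU; rewrite XAB (merged_unstarred sm) -/A -/B => /andP[_ BU].
      (* As [T] misses [A] and [a] is not in [B], the markers of the merged region are those that
         [B] had in [L]. *)
      rewrite setIUl AT set0U -(setIU1_out T (disj1 _ (regU _ BU) _)) ?h3 //.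
      by rewrite eq_sym.
    rewrite -(setIU1_out T (disj1 _ XR XA)) h3 //.
    by rewrite -(unmerged_unstarred sm).
  - move=> X; rewrite (sm_unstarred_crossings sm) in_setD1 => /andP[Xv XK].
    by rewrite -(setIU1_out T (disjv _ (croK _ XK) Xv)) h4.
(* From [L0] to [L]: the darts of [v] are at no crossing of [L0], so [T] has no marker at [v], and
   [a] supplies the one missing both there and in [A]. *)
case=> /stateP[h1 h2 h3 h4] AU /eqP AT.
have dA d : d \in T -> pblock R d != A.
  move=> dT; apply/eqP=> dA.
  have : d \in A :&: T by rewrite -dA inE mem_region.
  by rewrite AT inE.
have dv d : d \in T -> d \notin v.
  move=> dT; apply/negP=> /(sm_porbit_in sm)/negP[].
  by have := h2 d dT; rewrite inE => /andP[].
have aT : a \notin T by apply: contraL (sm_mem sm); apply: dv.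
have vT : v :&: T = set0.
  apply/eqP; rewrite setI_eq0 disjoint_sym; apply/pred0P=> d /=.
  by case: (boolP (d \in T)) => //= /dv/negPf.
split=> //; apply/stateP; split.
- move=> d; rewrite in_setU1 => /orP[/eqP->|dT] //.
  have := h1 d dT; rewrite -/R; have [dB|dB] := eqVneq (pblock R d) B.
    rewrite (smoothed_region_in sm) ?(merged_unstarred sm); last by right.
    by move=> /andP[_ BU]; rewrite dB.
  rewrite (smoothed_region_out sm) ?dA // (unmerged_unstarred sm) ?dA //.
  exact: region_mem.
- move=> d; rewrite in_setU1 => /orP[/eqP->|dT].
    by have := sm_mem sm; rewrite (mem_crossing _ vC) => /eqP->.
  have := h2 d dT; rewrite (sm_unstarred_crossings sm).
  rewrite (sm_porbit_out sm) ?dv //.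
  by rewrite in_setD1 => /andP[].
- move=> X XU; have [->|XA] := eqVneq X A.
    by rewrite setIU1_in ?cards1 // mem_region.
  rewrite setIU1_out ?disj1 // ?regU //; have [XB|XB] := eqVneq X B.
    (* Here [A] and [B] are both unstarred, so the merged region has one marker in [T]; it lies in
       [B] because [T] misses [A]. *)
    rewrite XB -(set0U (B :&: T)) -AT -setIUl h3 // (merged_unstarred sm).
    by rewrite AU -/B -XB.
  by rewrite h3 // (unmerged_unstarred sm) ?regU.
- move=> X XK; have [->|Xv] := eqVneq X v.
    by rewrite setIU1_in ?cards1 ?(sm_mem sm).
  rewrite setIU1_out ?disjv ?croK // h4 // (sm_unstarred_crossings sm).
  by rewrite in_setD1 Xv.
Qed.

(** * The oriented smoothing and the correspondence of states *)

Lemma crossing_porbit (D : finType) (L : diagram D) v d :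
  v \in crossings L -> d \in v ->
  porbit (rot L) d = v /\ #|porbit (rot L) d| = 4%N.
Proof.
move=> vC; have := vC; rewrite (mem_crossing _ vC) inE.
move=> /andP[_ /eqP v4] /eqP dv.
by rewrite dv.
Qed.

Lemma crossings_smoothing (D : finType) (L L0 : starred_diagram D) v o :
  oriented_smoothing_at L L0 v o -> crossings L0 = crossings L :\ v.
Proof.
move=> os; have vC := os_crossing os.
have [vE o4] := crossing_porbit vC (os_mem os).
apply/setP=> X; rewrite in_setD1 !inE; apply/andP/and3P.
  case=> /imsetP[d _ ->]; rewrite (os_rot os) => X4.
  have dv : d \notin porbit (rot L) o.
    by apply: contraL X4; apply: resolve_porbit_in.
  move: X4; rewrite resolve_porbit_out // => X4.
  split=> //; last exact: imset_f.
  by rewrite -vE eq_porbit_mem.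
case=> Xv /imsetP[d _ XE] X4; split=> //; apply/imsetP; exists d => //.
rewrite (os_rot os) resolve_porbit_out //.
by rewrite -eq_porbit_mem vE -XE.
Qed.

Lemma oriented_smoothing_merges (D : finType) (L L0 : starred_diagram D) v o :
  oriented_smoothing_at L L0 v o -> ~~ split_universe (rot L0) (opp L0) ->
  smoothing_merges L L0 v o (rot L (rot L o)).
Proof.
move=> os conn; have vC := os_crossing os.
have [vE o4] := crossing_porbit vC (os_mem os).
have card_R : #|regions L| = #|regions L0|.+1.
  exact: card_regions_resolve (os_rot os) (os_opp os) conn.
(* If the two regions were equal, merging would be the identity and no region would be lost, against
   [card_R]. *)
have neq : pblock (regions L) o != pblock (regions L) (rot L (rot L o)).
  apply: contra_eqN card_R => /eqP AB; rewrite (os_regions os) -AB.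
  rewrite (eq_imset _ (g := id)) ?imset_id ?neq_ltn ?ltnSn // => X.
  by rewrite /merge_blocks orbb setUid; case: eqP.
have unstarred_crossings0 :
    unstarred_crossings L0 = unstarred_crossings L :\ v.
  apply/setP=> X; rewrite /unstarred_crossings (crossings_smoothing os).
  by rewrite (os_starred_crossings os) !inE; case: (X =P v).
(* If [v] were starred, no region would be. Smoothing would then remove one unstarred region but no
   unstarred crossing, so [L] and [L0] could not both be balanced. *)
have v_unstarred : v \in unstarred_crossings L.
  rewrite inE vC andbT; apply/negP=> v_star.
  have [sr0|sc0] := stars_one_kind L; last by rewrite sc0 inE in v_star.
  have := stars_balanced L; have := stars_balanced L0.
  rewrite -!/(unstarred_crossings _) unstarred_crossings0.
  have -> : #|unstarred_crossings L :\ v| = #|unstarred_crossings L|.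
    by rewrite [RHS](cardsD1 v) inE v_star.
  rewrite (os_starred_regions os) sr0 imset0 !setD0 card_R => -> /eqP.
  by rewrite -[X in _ == X]addn0 -addn1 eqn_add2l.
split=> //.
- exact: os_mem os.
- by rewrite -vE crossing_darts // !inE eqxx !orbT.
- exact: os_regions os.
- exact: os_starred_regions os.
- move=> d dv; rewrite inE (os_rot os) negb_and resolve_porbit_in ?orbT //.
  by rewrite vE.
- by move=> d dv; rewrite (os_rot os) resolve_porbit_out // vE.
Qed.

(** If both regions were starred, every unstarred region of [L] would survive in [L0], which has one
    unstarred crossing less; this contradicts balance. *)
Lemma merged_region_unstarred (D : finType) (L L0 : starred_diagram D) v a b :
  smoothing_merges L L0 v a b ->
  (pblock (regions L) a \in unstarred_regions L)
    || (pblock (regions L) b \in unstarred_regions L).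
Proof.
move=> sm; apply/negPn/negP=> /norP[AU BU].
have UU0 : unstarred_regions L \subset unstarred_regions L0.
  apply/subsetP=> X XU; rewrite (unmerged_unstarred sm) //.
  - by apply: contraNneq AU => <-.
  - by apply: contraNneq BU => <-.
  - by move: XU; rewrite inE => /andP[].
have := subset_leq_card UU0.
rewrite !stars_balanced -!/(unstarred_crossings _) (sm_unstarred_crossings sm).
by rewrite (cardsD1 v (unstarred_crossings L)) (sm_crossing sm) ltnn.
Qed.

(** In view of [state_setU1], a state [T] of [L0] extends to a state of [L] by exactly one of the
    markers [a] and [b]. *)
Lemma marked_corner_unique (D : finType) (L L0 : starred_diagram D) v a b T :
  smoothing_merges L L0 v a b -> is_state L0 T ->
  (pblock (regions L) b \in unstarred_regions L)
    && (pblock (regions L) b :&: T == set0) =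
  ~~ ((pblock (regions L) a \in unstarred_regions L)
    && (pblock (regions L) a :&: T == set0)).
Proof.
move=> sm /stateP[h1 _ h3 _].
set A := pblock _ a; set B := pblock _ b.
have AB : A :&: B = set0.
  apply/eqP; rewrite setI_eq0.
  have /trivIsetP tI := partition_trivIset (regions_partition L).
  by apply: tI (sm_neq sm); apply: region_mem.
have no_marker : A :|: B \notin unstarred_regions L0 -> (A :|: B) :&: T = set0.
  move=> ABU; apply/eqP; rewrite setI_eq0 disjoint_sym; apply/pred0P=> d /=.
  apply/negP=> /andP[dT]; rewrite inE => dAB; case/negP: ABU.
  rewrite -(smoothed_region_in sm (d := d)) ?h1 //.
  by case/orP: dAB => /region_def->; rewrite ?region_mem; [left | | right |].
have := merged_region_unstarred sm; rewrite -/A -/B.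
have := h3 (A :|: B); move: no_marker; rewrite (merged_unstarred sm) -/A -/B.
case: (A \in _) (B \in _) => [] [] //= noT oneT _.
(* Both regions are unstarred: their disjoint sets of markers have sizes adding up to 1, so exactly
   one is empty. *)
- move: (oneT isT); rewrite setIUl cardsU setIACA AB set0I cards0 subn0.
  by rewrite -!cards_eq0; case: #|A :&: T| #|B :&: T| => [|[|n]] [|[|m]].
(* In the last two cases one region is starred. The merged region is then starred and has no marker,
   so the unstarred one is the only choice. *)
- by move: (noT isT) => /eqP; rewrite setIUl setU_eq0 => /andP[->].
- by move: (noT isT) => /eqP; rewrite setIUl setU_eq0 => /andP[_ ->].
Qed.

Lemma sum_states_marked (V : comNzRingType) (D : finType)
    (L L0 : starred_diagram D) v a b (F : D -> V) :
  smoothing_merges L L0 v a b ->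
  \sum_(S : {set D} | is_state L S && (a \in S)) \prod_(d in S :\ a) F d =
  \sum_(T : {set D} | is_state L0 T &&
      ((pblock (regions L) a \in unstarred_regions L)
        && (pblock (regions L) a :&: T == set0))) \prod_(d in T) F d.
Proof.
move=> sm.
rewrite (reindex_onto (fun T => a |: T) (fun S => S :\ a)) /=; last first.
  by move=> S /andP[_ aS]; rewrite setD1K.
(* The side condition produced by the reindexing is the first conjunct in [state_setU1]. *)
have E T : ((a |: T) :\ a == T) = (a \notin T).
  apply/eqP/idP => [<-|]; first by rewrite setD11.
  exact: setU1K.
apply: eq_big => T; last by move=> /andP[_ /eqP->].
by rewrite setU11 andbT E andbC (state_setU1 T sm).
Qed.

(** * Labels under crossing change and smoothing *)

Lemma label_eq (D : finType) (L L' : diagram D) d :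
  outgoing L' = outgoing L -> porbit (rot L') d = porbit (rot L) d ->
  (forall e, e \in porbit (rot L) d -> rot L' e = rot L e) ->
  (forall e, e \in porbit (rot L) d -> (e \in over L') = (e \in over L)) ->
  label L' d = label L d.
Proof.
move=> out_eq dE rot_eq over_eq.
have oc e : e \in porbit (rot L) d -> out_corner L' e = out_corner L e.
  by move=> ed; rewrite /out_corner out_eq rot_eq.
have ic e : e \in porbit (rot L) d -> in_corner L' e = in_corner L e.
  by move=> ed; rewrite /in_corner out_eq rot_eq.
rewrite /label dE oc ?ic ?porbit_id //.
congr (if _ then _ else _); apply: eq_existsb => e.
by case: (boolP (e \in _)) => //= ed; rewrite oc ?over_eq.
Qed.

(** Opposite darts at a crossing have opposite directions. With [o] and its successor outgoing, the
    other two darts are incoming, which determines the type of all four corners. *)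
Lemma corner_outP (D : finType) (L : diagram D) v o c :
  v \in crossings L -> o \in v -> out_corner L o -> c \in v ->
  out_corner L c = (c == o) /\ in_corner L c = (c == rot L (rot L o)).
Proof.
move=> vC ov; have [vE o4] := crossing_porbit vC ov.
have cr d : d \in v -> (rot L (rot L d) \in outgoing L) = (d \notin outgoing L).
  by move=> dv; apply: outgoing_crossing; have [] := crossing_porbit vC dv.
have mem i : iter i (rot L) o \in v by rewrite -vE -permX mem_porbit.
rewrite /out_corner /in_corner => /andP[o0 o1].
have := cr _ (mem 0); have := cr _ (mem 1); rewrite /= o0 o1 => o3 o2.
have := crossing_uniq o4.
rewrite /= !inE !negb_or => /and4P[/and3P[n1 n2 n3] /andP[n12 n13] n23 _].
rewrite -vE crossing_darts // !inE => /or4P[]/eqP->.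
all: rewrite ?crossing_rot4 // ?o0 ?o1 ?o2 ?o3 ?eqxx /=.
- by rewrite (negPf n2).
- by rewrite eq_sym (negPf n1) (negPf n12).
- by rewrite eq_sym (negPf n2).
- by rewrite eq_sym (negPf n3) eq_sym (negPf n23).
Qed.

Lemma label_difference (D : finType) (Lp Lm : starred_diagram D) v o c :
  crossing_change Lp Lm v -> o \in v -> out_corner Lp o -> c \in v ->
  label Lp c - label Lm c =
  if (c == o) || (c == rot Lp (rot Lp o)) then W - W^-1 else 0.
Proof.
move=> cc ov oo cv; have vC := cc_crossing cc.
have [oc ic] := corner_outP vC ov oo cv.
have [cE _] := crossing_porbit vC cv.
have -> : label Lm c = if c == o then W^-1
    else if c == rot Lp (rot Lp o) then - W else 1.
  rewrite /label (cc_rot cc) cE (negPf (cc_negative cc)).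
  by rewrite -oc -ic /out_corner /in_corner (cc_rot cc) (cc_outgoing cc).
rewrite /label cE (cc_positive cc) oc ic.
by case: eqP => // _; case: eqP => // _; rewrite ?subrr // opprK addrC.
Qed.

(** The sum has a single term, given by the marker of [S] at [v]; all other labels agree. Writing it
    as a sum allows corners and states to be exchanged later. *)
Lemma state_difference (D : finType) (Lp Lm : starred_diagram D) v S :
  crossing_change Lp Lm v -> v \in unstarred_crossings Lp -> is_state Lp S ->
  \prod_(d in S) label Lp d - \prod_(d in S) label Lm d =
  \sum_(c in v | c \in S)
    (label Lp c - label Lm c) * \prod_(d in S :\ c) label Lp d.
Proof.
move=> cc vK /stateP[_ _ _ /(_ v vK)/eqP/cards1P[c vS]].
have vC := cc_crossing cc.
rewrite [RHS](big_pred1 c) => [|e]; last first.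
  by have /setP/(_ e) := vS; rewrite !inE.
have /setIP[cv cS] : c \in v :&: S by rewrite vS set11.
rewrite !(big_setD1 c cS) /= mulrBl; congr (_ - _ * _).
apply: eq_bigr => d /setD1P[dc dS].
have dv : d \notin v.
  by apply: contra dc => dv; rewrite -in_set1 -vS inE dv.
apply: label_eq; rewrite ?(cc_outgoing cc) ?(cc_rot cc) // => e ed.
apply: (cc_over cc); apply: contra dv.
rewrite (mem_crossing _ vC) => /eqP<-.
by rewrite porbit_sym.
Qed.

Lemma label_smoothing (D : finType) (L L0 : starred_diagram D) v o d :
  oriented_smoothing_at L L0 v o -> d \notin v -> label L0 d = label L d.
Proof.
move=> os dv; have vC := os_crossing os.
have [vE o4] := crossing_porbit vC (os_mem os).
have ev e : e \in porbit (rot L) d -> e \notin v.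
  move=> ed; apply: contra dv; rewrite (mem_crossing _ vC) => /eqP<-.
  by rewrite porbit_sym.
apply: label_eq.
- exact: os_outgoing os.
- by rewrite (os_rot os) resolve_porbit_out // vE.
- by move=> e /ev ev'; rewrite (os_rot os) resolve_out // vE.
- by move=> e /ev ev'; rewrite (os_over os) inE ev'.
Qed.

(** * Comparison of the three state sums *)

Theorem theorem5 (D : finType) (Lp Lm L0 : starred_diagram D) (v : {set D}) :
  crossing_change Lp Lm v ->
  oriented_smoothing Lp L0 v ->
  ~~ separating Lp v ->
  mock_alexander Lp - mock_alexander Lm = (W - W^-1) * mock_alexander L0.
Proof.
move=> cc [o os] nonsep.
(* The oriented smoothing is the resolution at [o], one of those quantified over in [separating]. *)
have conn : ~~ split_universe (rot L0) (opp L0).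
  rewrite (os_rot os) (os_opp os).
  apply: contra nonsep => h; apply/exists_inP; exists o => //.
  exact: os_mem os.
have sm := oriented_smoothing_merges os conn.
have sm' := smoothing_merges_sym sm.
set r := rot Lp (rot Lp o) in sm sm'.
have or : o != r by apply: contraNneq (sm_neq sm) => <-.
have state_eq S : is_state Lm S = is_state Lp S.
  rewrite /is_state /crossings (cc_rot cc) (cc_regions cc).
  by rewrite (cc_starred_regions cc) (cc_starred_crossings cc).
rewrite /mock_alexander (eq_bigl _ _ state_eq) -sumrB.
rewrite (eq_bigr _ (fun S => state_difference cc (sm_crossing sm))).
rewrite (exchange_big_dep (mem v)) /=; last by move=> ? ? _ /andP[].
pose G c :=
  \sum_(S | is_state Lp S && (c \in S)) \prod_(d in S :\ c) label Lp d.
transitivity (\sum_(c in v) (label Lp c - label Lm c) * G c).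
  by apply: eq_bigr => c cv; rewrite mulr_sumr; apply: eq_bigl => S; rewrite cv.
(* Only the out-corner [o] and the in-corner [r] contribute, as side corners have label 1 for either
   sign. *)
rewrite (bigD1 o (os_mem os)) (bigD1 r) /=; last first.
  by apply/andP; split; [exact: sm_mem_opp sm | rewrite eq_sym].
rewrite big1 => [|c /andP[/andP[cv co] cr]]; last first.
  rewrite (label_difference cc (os_mem os) (os_out_corner os) cv).
  by rewrite (negPf co) (negPf cr) mul0r.
rewrite !(label_difference cc (os_mem os) (os_out_corner os)) ?(sm_mem sm)
  ?(sm_mem_opp sm) //.
rewrite !eqxx orbT addr0 -mulrDr; congr (_ * _).
rewrite /G (sum_states_marked _ sm) (sum_states_marked _ sm').
(* The states of [L0] are split according to whether the marker to be restored at [v] goes to [o];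
   by [marked_corner_unique] the remaining ones take it at [r]. *)
rewrite [RHS](bigID (fun T => (pblock (regions Lp) o \in unstarred_regions Lp)
        && (pblock (regions Lp) o :&: T == set0))) /=.
have label_state T : is_state L0 T ->
    \prod_(d in T) label Lp d = \prod_(d in T) label L0 d.
  move=> /stateP[_ h2 _ _]; apply: eq_bigr => d dT.
  rewrite (label_smoothing os) //; apply/negP=> /(sm_porbit_in sm)/negP[].
  by have := h2 d dT; rewrite inE => /andP[].
congr (_ + _); first by apply: eq_bigr => T /andP[/label_state].
apply: eq_big => T; last by move=> /andP[/label_state].
by case: (boolP (is_state L0 T)) => //= /(marked_corner_unique sm).
Qed.
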